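(* Let $f:\mathbb{S}^1\simeq[0,1)\to\mathbb{R}$ be given by $f(\vartheta)=\vartheta$ for $\vartheta\le\frac12$ and $f(\vartheta)=1-\vartheta$ for $\vartheta\ge\frac12$, and consider, for $\alpha>0$, $\sigma>0$, $b\neq0$, the stochastic differential equation on $\mathbb{R}\times\mathbb{S}^1$ $$\mathrm{d}y=-\alpha y\,\mathrm{d}t+\sigma f(\vartheta)\circ \mathrm{d}W_t^1,\qquad \mathrm{d}\vartheta=(1+by)\,\mathrm{d}t .$$ Then its top Lyapunov exponent $\lambda_1(\alpha,b,\sigma)$, as given by $$\lambda_1(\alpha,b,\sigma)=-\frac{\alpha}{2}+\frac{|b\sigma|}{2}\int_0^\infty v\,m_{\sigma,b,\alpha}(v)\,\mathrm{d}v,\qquad m_{\sigma,b,\alpha}(v)=\frac{\frac{1}{\sqrt v}\exp\left(-\frac{|b\sigma|}{6}v^3+\frac{\alpha^2}{2|b\sigma|}v\right)}{\int_0^\infty\frac{1}{\sqrt u}\exp\left(-\frac{|b\sigma|}{6}u^3+\frac{\alpha^2}{2|b\sigma|}u\right)\mathrm{d}u},$$ satisfies $$\lambda_1(k\alpha,kb,\sqrt{k}\,\sigma)=k\,\lambda_1(\alpha,b,\sigma)\quad\text{for all } k>0 .$$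
   Context: $W^1$ is a one-dimensional Brownian motion, and $\mathbb{S}^1$ is $[0,1]$ with endpoints identified. $f'$ denotes the weak derivative of $f$ (equal to $1$ on $(0,\frac12)$ and $-1$ on $(\frac12,1)$), with an arbitrary choice of values at $0$ and $\frac12$. Top Lyapunov exponent: the SDE generates a continuous random dynamical system $\varphi(t,\omega)$ on $\mathbb{R}\times\mathbb{S}^1$ over the Wiener shift $(\theta_t)$, and the associated skew product flow has an ergodic invariant Markov measure $\mu$ on $\Omega\times(\mathbb{R}\times\mathbb{S}^1)$, associated to the unique stationary measure of the Markov semigroup. Along a trajectory $(y_t,\vartheta_t)=\varphi(t,\omega)x$ the linearization $v_t=D\varphi(t,\omega,x)v_0\in\mathbb{R}^2$ solves the variational equation $$\mathrm{d}v=\begin{pmatrix}-\alpha&0\\ b&0\end{pmatrix}v\,\mathrm{d}t+\begin{pmatrix}0&\sigma f'(\vartheta_t)\\0&0\end{pmatrix}v\circ \mathrm{d}W_t^1 .$$ By the Multiplicative Ergodic Theorem, for $\mu$-almost every $(\omega,x)$ the limit $\lim_{t\to\infty}\frac1t\log\|D\varphi(t,\omega,x)v_0\|$ exists for every $v_0\ne0$ and takes finitely many values, which do not depend on $(\omega,x)$; $\lambda_1(\alpha,b,\sigma)$ is the largest of these values, and it is given by the integral formula displayed in the claim. *)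

(* Defs.v *)
From HB Require Import structures.
From mathcomp Require Import all_boot all_order all_algebra.
From mathcomp Require Import all_classical all_reals all_analysis.

Set Implicit Arguments.
Unset Strict Implicit.
Unset Printing Implicit Defensive.

Import Order.TTheory GRing.Theory Num.Theory.
Import numFieldNormedType.Exports.

Local Open Scope classical_set_scope.
Local Open Scope ring_scope.

(* The circle [0,1] / (0 ~ 1), each point being named by its representative
   in [0,1); it carries the topology of the unit circle of the plane and the
   corresponding Borel sigma-algebra. *)

Definition circle (R : realType) := {x : R | 0 <= x < 1}.

Definition angle (R : realType) (p : circle R) : R := sval p.

Lemma frac_itv (R : realType) (x : R) :
  0 <= x - (Num.floor x)%:~R < 1.
Proof.
rewrite subr_ge0 floor_le /= ltrBlDl.
by have := floorD1_gt x; rewrite intrD1.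
Qed.

Definition to_circle (R : realType) (x : R) : circle R :=
  exist _ (x - (Num.floor x)%:~R) (frac_itv x).

Definition circle_embedding (R : realType) (p : circle R) : R * R :=
  (cos (2 * pi * angle p), sin (2 * pi * angle p)).

HB.instance Definition _ (R : realType) := Choice.on (circle R).
HB.instance Definition _ (R : realType) :=
  isPointed.Build (circle R) (to_circle 0).
HB.instance Definition _ (R : realType) :=
  Topological.copy (circle R) (initial_topology (@circle_embedding R)).

Definition circle_display (R : realType) : measure_display :=
  sigma_display (@open (circle R)).

HB.instance Definition _ (R : realType) :=
  @isMeasurable.Build (circle_display R) (circle R) <<s @open (circle R) >>
    (@sigma_algebra0 _ setT open) (@sigma_algebraC _ open)
    (@sigma_algebra_bigcup _ setT open).

Definition tent (R : realType) (p : circle R) : R :=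
  if angle p <= 2^-1 then angle p else 1 - angle p.

(* The values of df at the classes of 0 and 1/2 are left arbitrary. *)
Definition is_tent_weak_derivative (R : realType) (df : circle R -> R) : Prop :=
  forall p, (0 < angle p < 2^-1 -> df p = 1) /\ (2^-1 < angle p < 1 -> df p = -1).

Notation state R := (R * circle R)%type.

Section Noise.
Context {R : realType} {d : measure_display} {Omega : measurableType d}.
Variables (P : probability Omega R) (W : R -> Omega -> R).

(* For increasing times, joint law of the increments: independent, centred
   Gaussian with variance the length of the time interval. *)
Definition is_two_sided_brownian_motion : Prop :=
  [/\ forall t, measurable_fun setT (W t),
      forall w, W 0 w = 0,
      forall w, continuous (fun t => W t w) &
      forall (n : nat) (t : nat -> R) (B : nat -> set R),
        (forall i, (i < n)%N -> t i < t i.+1) ->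
        (forall i, measurable (B i)) ->
        P [set w | forall i, (i < n)%N -> B i (W (t i.+1) w - W (t i) w)] =
        (\prod_(i < n) normal_prob 0 (Num.sqrt (t i.+1 - t i)) (B i))%E].

(* Sigma-algebra generated by the W t, t in I, and the P-null events. *)
Definition noise_sigma (I : set R) : set (set Omega) :=
  <<s [set A | exists t B, [/\ I t, measurable B & A = W t @^-1` B]] `|`
      [set A | measurable A /\ P A = 0%E] >>.

(* Omega stands for the Wiener space, possibly completed: up to null events
   its sigma-algebra is generated by W. *)
Definition is_wiener_shift (theta : R -> Omega -> Omega) : Prop :=
  [/\ is_two_sided_brownian_motion,
      forall A, measurable A -> noise_sigma setT A,
      forall t, measurable_fun setT (theta t),
      (forall w, theta 0 w = w) /\
      (forall s t w, theta (s + t) w = theta s (theta t w)) &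
      (forall t A, measurable A -> P (theta t @^-1` A) = P A) /\
      (forall s t w, W t (theta s w) = W (t + s) w - W s w)].

Definition trapezoid_sum (H : R -> Omega -> R) (n : nat) (p : nat -> R)
    (w : Omega) : R :=
  \sum_(i < n) (H (p i) w + H (p i.+1) w) / 2 * (W (p i.+1) w - W (p i) w).

(* I is the Stratonovich integral of H against W over [0,t]: the limit in
   probability of the trapezoidal sums as the mesh tends to 0. *)
Definition is_stratonovich_integral (H : R -> Omega -> R) (t : R)
    (I : Omega -> R) : Prop :=
  forall e : R, 0 < e -> exists2 delta : R, 0 < delta &
    forall (n : nat) (p : nat -> R), p 0%N = 0 -> p n = t ->
      (forall i, (i < n)%N -> p i <= p i.+1 < p i + delta) ->
      exists N : set Omega, [/\ measurable N, (P N <= e%:E)%E &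
        [set w | e <= `|trapezoid_sum H n p w - I w|] `<=` N].

End Noise.

Section Dynamics.
Context {R : realType} {d : measure_display} {Omega : measurableType d}.
Variables (P : probability Omega R) (W : R -> Omega -> R).
Variable theta : R -> Omega -> Omega.
Variable df : circle R -> R.
Variables alpha b sigma : R.

Local Notation leb := (@lebesgue_measure R).

Definition is_continuous_rds (phi : R -> Omega -> state R -> state R) : Prop :=
  [/\ forall t : R, 0 <= t ->
        measurable_fun setT (fun z : Omega * state R => phi t z.1 z.2),
      forall w, {within [set z : R * state R | 0 <= z.1],
                   continuous (fun z : R * state R => phi z.1 w z.2)},
      forall w x, phi 0 w x = x &
      forall (s t : R) w x, 0 <= s -> 0 <= t ->
        phi (t + s) w x = phi t (theta s w) (phi s w x)].

Definition generated_by_sde (phi : R -> Omega -> state R -> state R) : Prop :=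
  forall x : state R,
  [/\ forall (t : R) (B : set (state R)), 0 <= t -> measurable B ->
        noise_sigma P W `[0, t] [set w | B (phi t w x)],
      forall t : R, 0 <= t ->
        is_stratonovich_integral P W
          (fun s w => sigma * tent (phi s w x).2) t
          (fun w => (phi t w x).1 - x.1
             - Rintegral leb `[0, t] (fun s => - alpha * (phi s w x).1)) &
      {ae P, forall w, forall t : R, 0 <= t ->
        (phi t w x).2 = to_circle (angle x.2
             + Rintegral leb `[0, t] (fun s => 1 + b * (phi s w x).1))}].

Definition drift_mx : 'M[R]_2 :=
  \matrix_(i, j) (if j == 0 then (if i == 0 then - alpha else b) else 0).

Definition noise_mx (p : circle R) : 'M[R]_2 :=
  \matrix_(i, j) (if (i == 0) && (j != 0) then sigma * df p else 0).

(* D t w x plays the role of the differential of phi t w at x. As tent is only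
   weakly differentiable, it is the solution operator of the variational
   equation along the trajectory of x; it is adapted jointly in (w, x). *)
Definition is_linearization (phi : R -> Omega -> state R -> state R)
    (D : R -> Omega -> state R -> 'M[R]_2) : Prop :=
  (forall (t : R) i j (B : set R), 0 <= t -> measurable B ->
     <<s [set A `*` C | A in noise_sigma P W `[0, t]
                      & C in @measurable _ (state R)] >>
       [set z : Omega * state R | B (D t z.1 z.2 i j)]) /\
  forall x : state R,
    {ae P, forall w, forall i j,
       {within `[0, +oo[, continuous (fun t : R => D t w x i j)}} /\
    forall (v0 : 'cV[R]_2) (t : R) (i : 'I_2), 0 <= t ->
      let v s w := D s w x *m v0 in
      is_stratonovich_integral P W
        (fun s w => (noise_mx (phi s w x).2 *m v s w) i 0) t
        (fun w => v t w i 0 - v0 i 0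
           - Rintegral leb `[0, t] (fun s => (drift_mx *m v s w) i 0)).

Definition is_stationary (phi : R -> Omega -> state R -> state R)
    (rho : probability (state R) R) : Prop :=
  forall (t : R) (B : set (state R)), 0 <= t -> measurable B ->
    (rho B = \int[rho]_x P [set w | B (phi t w x)])%E.

Definition skew_product (phi : R -> Omega -> state R -> state R) (t : R)
    (z : Omega * state R) : Omega * state R :=
  (theta t z.1, phi t z.1 z.2).

(* The last clause is the Markov property of mu: its disintegration
   (mu_w) over P is measurable with respect to the past of the noise, i.e.
   x and the future of the noise are independent given the past. *)
Definition is_ergodic_markov_measure
    (phi : R -> Omega -> state R -> state R)
    (rho : probability (state R) R)
    (mu : probability (Omega * state R)%type R) : Prop :=
  [/\ forall A, measurable A -> mu (A `*` setT) = P A,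
      forall B, measurable B -> mu (setT `*` B) = rho B,
      forall (t : R) U, 0 <= t -> measurable U ->
        mu (skew_product phi t @^-1` U) = mu U,
      forall U, measurable U ->
        (forall t : R, 0 <= t -> skew_product phi t @^-1` U = U) ->
        mu U = 0%E \/ mu U = 1%E &
      forall A C B, noise_sigma P W `[0, +oo[ A -> noise_sigma P W `]-oo, 0] C ->
        measurable B ->
        (mu ((A `&` C) `*` B) = P A * mu (C `*` B))%E].

Definition euclidean_norm (v : 'cV[R]_2) : R :=
  Num.sqrt (\sum_i v i 0 ^+ 2).

Definition has_lyapunov_limit (D : R -> Omega -> state R -> 'M[R]_2)
    (w : Omega) (x : state R) (v0 : 'cV[R]_2) (l : R) : Prop :=
  ln (euclidean_norm (D t w x *m v0)) / t @[t --> +oo] --> l.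

Definition is_top_lyapunov_exponent (lambda : R) : Prop :=
  exists (phi : R -> Omega -> state R -> state R)
         (D : R -> Omega -> state R -> 'M[R]_2)
         (rho : probability (state R) R)
         (mu : probability (Omega * state R)%type R)
         (spectrum : seq R),
  [/\ is_continuous_rds phi /\ generated_by_sde phi,
      is_linearization phi D,
      is_stationary phi rho /\ is_ergodic_markov_measure phi rho mu,
      {ae mu, forall z : Omega * state R,
         (forall v0 : 'cV[R]_2, v0 != 0 ->
            exists2 l, l \in spectrum & has_lyapunov_limit D z.1 z.2 v0 l) /\
         (forall l, l \in spectrum ->
            exists2 v0 : 'cV[R]_2, v0 != 0 &
              has_lyapunov_limit D z.1 z.2 v0 l)} &
      lambda \in spectrum /\ forall l, l \in spectrum -> l <= lambda].

End Dynamics.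

Definition m_weight (R : realType) (sigma b alpha v : R) : R :=
  (Num.sqrt v)^-1 *
  expR (- (`|b * sigma| / 6) * v ^+ 3 + alpha ^+ 2 / (2 * `|b * sigma|) * v).

Definition m_density (R : realType) (sigma b alpha v : R) : R :=
  m_weight sigma b alpha v /
  Rintegral (@lebesgue_measure R) `]0, +oo[ (m_weight sigma b alpha).

Definition lyapunov_formula (R : realType) (alpha b sigma : R) : R :=
  - (alpha / 2) + `|b * sigma| / 2 *
    Rintegral (@lebesgue_measure R) `]0, +oo[
      (fun v => v * m_density sigma b alpha v).

(* Main.v *)
Require Import Defs.
From mathcomp Require Import all_boot all_order all_algebra.
From mathcomp Require Import all_classical all_reals all_analysis.
From mathcomp Require Import measurable_realfun ring.
Import Order.TTheory GRing.Theory Num.Theory.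
Local Open Scope classical_set_scope.
Local Open Scope ring_scope.

(** In the variational equation the phase enters only through a sign in front of
the noise, and integrating this sign against [W] gives again a Brownian motion.
Multiplying [alpha] and [b] by [k] and [sigma] by [Num.sqrt k] is therefore a
change of the unit of time, under which an exponential rate is multiplied by [k].

On the integral formula this reads as follows.  With [s := Num.sqrt k], the
strength [`|b * sigma|] is multiplied by [s ^+ 3] while
[alpha ^+ 2 / `|b * sigma|] is multiplied by [s].  Hence both terms in the
exponent of the weight are functions of [s * v]: the new weight at [v] is the old
weight at [s * v], times [Num.sqrt s] ([m_weight_rescale]).  The substitution
[u = s * v] ([Rintegral_itv0y_dilation]) then shows that the new density is the
dilated density [s * m (s * v)] ([m_density_rescale]), whose mean is the old mean
divided by [s].  The factor [`|b * sigma| / 2] in front of the mean is multiplied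
by [s ^+ 3], so that the product is multiplied by [s ^+ 2 = k], just like
[alpha / 2].

The factor [(Num.sqrt v)^-1] is singular at [0], so the substitution is carried
out on the measure rather than by a theorem about continuous integrands: the
image of Lebesgue measure under a dilation is a multiple of Lebesgue measure
([lebesgue_measure_dilation]). *)

(** By uniqueness of Lebesgue measure it suffices to compare the two sides on
the intervals [`]a, b]]. *)
Lemma lebesgue_measure_dilation (R : realType) (s : {posnum R}) (A : set R) :
  measurable A ->
  @lebesgue_measure R A =
  (s%:num%:E * @lebesgue_measure R ( *%R s%:num @^-1` A))%E.
Proof.
move: A; apply: (@lebesgue_measure_unique _ (mscale s%:num%:nng
  (pushforward lebesgue_measure ( *%R s%:num : R -> measurableTypeR R)))) => //.
move=> _ [[a b] _ <-].
change (lebesgue_measure `]a, b] =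
  (s%:num%:E * lebesgue_measure ( *%R s%:num @^-1` `]a, b]))%E).
have -> : *%R s%:num @^-1` `]a, b] =
    `](a / s%:num), (b / s%:num)]%classic.
  apply/seteqP; split => x /=;
    by rewrite !in_itv /= ltr_pdivrMr // ler_pdivlMr // mulrC.
rewrite !lebesgue_measure_itv /= !lte_fin ltr_pM2r ?invr_gt0//.
case: ifP => _; last by rewrite mule0.
by rewrite -!EFinB -EFinM -mulrBl mulrC divfK.
Qed.

Lemma ge0_integral_dilation (R : realType) (s : {posnum R}) (D : set R)
    (f : R -> \bar R) :
  measurable D -> measurable_fun D f -> (forall x, D x -> (0 <= f x)%E) ->
  (\int[@lebesgue_measure R]_(x in D) f x =
   s%:num%:E * \int[@lebesgue_measure R]_(x in *%R s%:num @^-1` D)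
                  f (s%:num * x)%R)%E.
Proof.
move=> mD mf f0.
rewrite (@eq_measure_integral _ _ _ _ (mscale s%:num%:nng
  (pushforward lebesgue_measure ( *%R s%:num : R -> measurableTypeR R)))) => //.
  by rewrite ge0_integral_mscale//= ge0_integral_pushforward// => x;
    rewrite inE; exact: f0.
by move=> A mA _; exact: lebesgue_measure_dilation.
Qed.

(** As [fine] maps both infinities to [0], this includes infinite [x]: integrals
can be rescaled before anything is known about their convergence. *)
Lemma fine_mulEFin (R : realType) (r : R) (x : \bar R) :
  fine (r%:E * x) = r * fine x.
Proof.
case: x => [x| |] //=; rewrite mulr0; case: (ltgtP r 0) => [r0|r0|->].
- by rewrite lt0_muley.
- by rewrite gt0_muley.
- by rewrite mul0e.
- by rewrite lt0_muleNy.
- by rewrite gt0_muleNy.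
- by rewrite mul0e.
Qed.

Lemma ge0_RintegralZl (R : realType) (D : set R) (c : R) (f : R -> R) :
  measurable D -> measurable_fun D f -> (forall x, D x -> 0 <= f x) -> 0 <= c ->
  Rintegral (@lebesgue_measure R) D (fun x => c * f x) =
  c * Rintegral (@lebesgue_measure R) D f.
Proof.
move=> mD mf f0 c0; rewrite /Rintegral -fine_mulEFin; congr fine.
by rewrite -ge0_integralZl//; exact/measurable_EFinP.
Qed.

Lemma Rintegral_itv0y_dilation (R : realType) (s : R) (f : R -> R) :
  0 < s -> measurable_fun (`]0, +oo[%classic : set R) f ->
  (forall x, 0 < x -> 0 <= f x) ->
  Rintegral (@lebesgue_measure R) `]0, +oo[ (fun x => f (s * x)) =
  s^-1 * Rintegral (@lebesgue_measure R) `]0, +oo[ f.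
Proof.
move=> s0 mf f0.
rewrite /Rintegral (@ge0_integral_dilation R (PosNum s0) _ (EFin \o f)) //=;
  [| exact/measurable_EFinP | ]; last first.
  by move=> x /=; rewrite in_itv /= andbT lee_fin; exact: f0.
have -> : *%R s @^-1` `]0, +oo[%classic = `]0, +oo[%classic.
  by apply/seteqP; split => x /=; rewrite !in_itv /= !andbT pmulr_rgt0.
by rewrite fine_mulEFin mulKf ?gt_eqF.
Qed.

Lemma measurable_m_weight (R : realType) (sigma b alpha : R) :
  measurable_fun (`]0, +oo[%classic : set R) (m_weight sigma b alpha).
Proof.
apply: measurable_funM; last first.
  apply: measurable_funTS; apply: measurableT_comp => //.
  by apply: measurable_funD; apply: measurable_funM.
(* On the positive half-line the singular factor is a real power. *)
apply: (eq_measurable_fun (fun v : R => v `^ (- 2^-1))).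
  move=> v; rewrite inE /= in_itv /= andbT => v0.
  by rewrite powRN powR12_sqrt// ltW.
by apply: measurable_funTS; exact: measurable_powR.
Qed.

Lemma m_weight_ge0 (R : realType) (sigma b alpha v : R) :
  0 <= m_weight sigma b alpha v.
Proof. by rewrite mulr_ge0 ?expR_ge0// invr_ge0 sqrtr_ge0. Qed.

Lemma m_density_ge0 (R : realType) (sigma b alpha v : R) :
  0 <= m_density sigma b alpha v.
Proof.
rewrite divr_ge0 ?m_weight_ge0//.
by apply: Rintegral_ge0 => x _; exact: m_weight_ge0.
Qed.

Lemma normr_strength_rescale (R : realType) (b sigma k : R) : 0 < k ->
  `|k * b * (Num.sqrt k * sigma)| = Num.sqrt k ^+ 3 * `|b * sigma|.
Proof.
move=> k0; rewrite -{1}(sqr_sqrtr (ltW k0)) mulrACA -exprSr normrM.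
by rewrite ger0_norm// exprn_ge0// sqrtr_ge0.
Qed.

Lemma m_weight_rescale (R : realType) (alpha b sigma k v : R) :
  0 < sigma -> b != 0 -> 0 < k -> let s := Num.sqrt k in
  m_weight (s * sigma) (k * b) (k * alpha) v =
  Num.sqrt s * m_weight sigma b alpha (s * v).
Proof.
move=> sigma0 b0 k0 s; have s_gt0 : 0 < s by rewrite sqrtr_gt0.
rewrite /m_weight normr_strength_rescale// -/s.
have c0 : `|b * sigma| != 0 by rewrite normr_eq0 mulf_neq0// gt_eqF.
have s0 : s != 0 by rewrite gt_eqF.
have r0 : Num.sqrt s != 0 by rewrite gt_eqF// sqrtr_gt0.
rewrite (sqrtrM v (ltW s_gt0)) [X in _ = _ * (X * _)]invfM mulrA mulVKf//.
congr (_ * expR _); rewrite -(sqr_sqrtr (ltW k0)) -/s.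
by field; rewrite c0 s0.
Qed.

(** The normalising integral is multiplied by [Num.sqrt s / s]; together with the
factor [Num.sqrt s] of the weight this leaves the factor [s]. *)
Lemma m_density_rescale (R : realType) (alpha b sigma k v : R) :
  0 < sigma -> b != 0 -> 0 < k -> let s := Num.sqrt k in
  m_density (s * sigma) (k * b) (k * alpha) v =
  s * m_density sigma b alpha (s * v).
Proof.
move=> sigma0 b0 k0 s; have s_gt0 : 0 < s by rewrite sqrtr_gt0.
have r0 : Num.sqrt s != 0 by rewrite gt_eqF// sqrtr_gt0.
pose w := m_weight sigma b alpha.
have mw : measurable_fun (`]0, +oo[%classic : set R) w.
  exact: measurable_m_weight.
rewrite /m_density (m_weight_rescale _ _ _ _ _ v sigma0 b0 k0) -/s.
rewrite (@eq_Rintegral _ _ R lebesgue_measure _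
  (fun u => Num.sqrt s * w (s * u))); last first.
  by move=> u _; exact: m_weight_rescale.
rewrite (Rintegral_itv0y_dilation R s (fun u => Num.sqrt s * w u))//; last 2 first.
- exact: measurable_funM.
- by move=> x _; rewrite mulr_ge0 ?sqrtr_ge0 ?m_weight_ge0.
rewrite ge0_RintegralZl ?sqrtr_ge0//; last by move=> x _; exact: m_weight_ge0.
rewrite !invfM invrK -/w.
(* As an atom, the inverse of the integral does not oblige field to prove that
   the integral is nonzero. *)
by set z := (Rintegral _ _ _)^-1; field.
Qed.

Lemma lyapunov_formula_rescale (R : realType) (alpha b sigma k : R) :
  0 < sigma -> b != 0 -> 0 < k -> let s := Num.sqrt k in
  lyapunov_formula (k * alpha) (k * b) (s * sigma) =
  k * lyapunov_formula alpha b sigma.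
Proof.
move=> sigma0 b0 k0 s; have s_gt0 : 0 < s by rewrite sqrtr_gt0.
pose g v := v * m_density sigma b alpha v.
rewrite /lyapunov_formula normr_strength_rescale// -/s.
rewrite (@eq_Rintegral _ _ R lebesgue_measure _
  (fun v => g (s * v))); last first.
  move=> v _; rewrite (m_density_rescale _ _ _ _ _ v sigma0 b0 k0) -/s /g.
  by rewrite mulrA (mulrC v).
rewrite (Rintegral_itv0y_dilation R s g)//; last 2 first.
- apply: measurable_funM => //; apply: measurable_funM => //.
  exact: measurable_m_weight.
- by move=> v v0; rewrite mulr_ge0 ?m_density_ge0// ltW.
rewrite -(sqr_sqrtr (ltW k0)) -/s.
by field; rewrite gt_eqF.
Qed.

Theorem proposition3p3 (R : realType) :
  (forall alpha b sigma k : R, 0 < alpha -> 0 < sigma -> b != 0 -> 0 < k ->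
     lyapunov_formula (k * alpha) (k * b) (Num.sqrt k * sigma) =
     k * lyapunov_formula alpha b sigma)
  /\
  (forall (d : measure_display) (Omega : measurableType d)
          (P : probability Omega R) (W : R -> Omega -> R)
          (theta : R -> Omega -> Omega) (df : circle R -> R)
          (lambda1 : R -> R -> R -> R),
     is_wiener_shift P W theta ->
     is_tent_weak_derivative df ->
     (forall alpha b sigma : R, 0 < alpha -> 0 < sigma -> b != 0 ->
        is_top_lyapunov_exponent P W theta df alpha b sigma
          (lambda1 alpha b sigma)) ->
     (forall alpha b sigma : R, 0 < alpha -> 0 < sigma -> b != 0 ->
        lambda1 alpha b sigma = lyapunov_formula alpha b sigma) ->
     forall alpha b sigma k : R, 0 < alpha -> 0 < sigma -> b != 0 -> 0 < k ->
       lambda1 (k * alpha) (k * b) (Num.sqrt k * sigma) =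
       k * lambda1 alpha b sigma).
Proof.
split => [alpha b sigma k _ sigma0 b0 k0|d Omega P W theta df lambda1 _ _ _ lambda1E].
  exact: lyapunov_formula_rescale.
move=> alpha b sigma k alpha0 sigma0 b0 k0.
rewrite !lambda1E ?mulr_gt0 ?sqrtr_gt0 ?mulf_neq0 ?(gt_eqF k0)//.
exact: lyapunov_formula_rescale.
Qed.
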